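(* Let $(\Omega,\mu)$ be an arbitrary measure space with positive measure $\mu$. Then the pair $(c_0, L_1(\mu))$ has the Bishop-Phelps-Bollobás property for positive operators. Moreover, the elements in the definition of this property can be chosen to preserve positivity of the point: for every $0<\varepsilon<1$ there exists $0<\eta(\varepsilon)<\varepsilon$ such that for every positive operator $S\in S_{L(c_0,L_1(\mu))}$ and every $x_0\in S_{c_0}$ with $\|S(x_0)\|_1>1-\eta(\varepsilon)$, there exist $u_0\in S_{c_0}$ and a positive operator $T\in S_{L(c_0,L_1(\mu))}$ such that $\|T(u_0)\|_1=1$, $\|u_0-x_0\|<\varepsilon$, $\|T-S\|<\varepsilon$, and, if $x_0\ge 0$, then also $u_0\ge 0$.
   Context: All spaces are real. $c_0$ is the space of real sequences converging to $0$ with the supremum norm and the coordinatewise order, and $L_1(\mu)$ is the space of real-valued $\mu$-integrable functions with its usual norm $\|\cdot\|_1$ and the almost everywhere pointwise order; both are Banach lattices. For a Banach space $X$, $S_X$ denotes its unit sphere. $L(X,Y)$ is the space of bounded linear operators from $X$ to $Y$ with the operator norm. A linear operator $T:X\to Y$ between ordered vector spaces is positive (written $T\ge 0$) if $x\ge 0$ implies $Tx\ge 0$. An element $x$ of an ordered vector space is called positive if $x\ge 0$. Definition. Let $X$ and $Y$ be Banach lattices. The pair $(X,Y)$ has the Bishop-Phelps-Bollobás property for positive operators if for every $0<\varepsilon<1$ there exists $0<\eta(\varepsilon)<\varepsilon$ such that for every $S\in S_{L(X,Y)}$ with $S\ge 0$, if $x_0\in S_X$ satisfies $\|S(x_0)\|>1-\eta(\varepsilon)$,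 then there exist an element $u_0\in S_X$ and a positive operator $T\in S_{L(X,Y)}$ such that $\|T(u_0)\|=1$, $\|u_0-x_0\|<\varepsilon$ and $\|T-S\|<\varepsilon$. *)

(* Defs.v *)
From HB Require Import structures.
From mathcomp Require Import all_boot all_order all_algebra.
From mathcomp Require Import all_classical all_reals all_analysis.
From mathcomp Require Import generic_quotient measurable_realfun.

Set Implicit Arguments.
Unset Strict Implicit.
Unset Printing Implicit Defensive.

Import Order.TTheory GRing.Theory Num.Theory numFieldNormedType.Exports.

Local Open Scope classical_set_scope.
Local Open Scope ring_scope.

Reserved Notation "x <=L y" (at level 70, no associativity).

(* The order is a field of the mixin because the HB class of [numDomainType]
   leaves no room for a join of [normedModType] with [porderType].
   Infima need not be given: inf x y = - sup (- x) (- y). *)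
HB.mixin Record isBanachLattice (R : realType) E
    & CompleteNormedModule R E := {
  vle : E -> E -> Prop ;
  vsup : E -> E -> E ;
  vle_refl : forall x, vle x x ;
  vle_anti : forall x y, vle x y -> vle y x -> x = y ;
  vle_trans : forall y x z, vle x y -> vle y z -> vle x z ;
  vle_supl : forall x y, vle x (vsup x y) ;
  vle_supr : forall x y, vle y (vsup x y) ;
  vsup_le : forall x y z, vle x z -> vle y z -> vle (vsup x y) z ;
  vleD2r : forall z x y, vle x y -> vle (x + z) (y + z) ;
  vscale_ge0 : forall (a : R) x, 0 <= a -> vle 0 x -> vle 0 (a *: x) ;
  vnorm_solid : forall x y,
    vle (vsup x (- x)) (vsup y (- y)) -> `|x| <= `|y|
}.

#[short(type="banachLatticeType")]
HB.structure Definition BanachLattice (R : realType) :=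
  {E of CompleteNormedModule R E & isBanachLattice R E}.

Notation "x <=L y" := (vle x y) : ring_scope.

Section operators.
Context {R : realType}.

Definition bounded_operator (X Y : normedModType R) (T : X -> Y) : Prop :=
  bounded_near T (nbhs (0 : X)).

(* [sup] of an unbounded set is 0, so this is only meaningful together with
   [bounded_operator]. *)
Definition opnorm (X Y : normedModType R) (T : X -> Y) : R :=
  sup [set `|T x| | x in [set x : X | `|x| <= 1]].

Definition norm1_operator (X Y : normedModType R) (T : X -> Y) : Prop :=
  bounded_operator T /\ opnorm T = 1.

Definition positive_operator (X Y : banachLatticeType R) (T : X -> Y) : Prop :=
  forall x : X, 0 <=L x -> 0 <=L T x.

Definition BPBp_positive (X Y : banachLatticeType R) : Prop :=
  forall eps : R, 0 < eps < 1 ->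
  exists2 eta : R, 0 < eta < eps &
    forall S : {linear X -> Y}, norm1_operator S -> positive_operator S ->
    forall x0 : X, `|x0| = 1 -> `|S x0| > 1 - eta ->
    exists (u0 : X) (T : {linear X -> Y}),
      [/\ `|u0| = 1, norm1_operator T /\ positive_operator T,
          `|T u0| = 1, `|u0 - x0| < eps & opnorm (T \- S) < eps].

End operators.

Section c0.
Context {R : realType}.

Definition c0_pred : {pred nat -> R^o} :=
  mem [set u : nat -> R^o | u n @[n --> \oo] --> (0 : R^o)].

Lemma c0_submod_closed : submod_closed c0_pred.
Proof.
split => [|a u v]; first by rewrite inE; exact: cvg_cst.
rewrite !inE => u0 v0.
have := cvgD (cvgZl_tmp (k := a) u0) v0; rewrite scaler0 addr0.
by move=> h; exact: h.
Qed.

HB.instance Definition _ :=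
  GRing.isSubmodClosed.Build R (nat -> R^o) c0_pred c0_submod_closed.

End c0.

Record c0 (R : realType) := C0 {
  c0_seq :> nat -> R^o ;
  c0_seqP : c0_seq \in c0_pred }.

Section c0_banach.
Context {R : realType}.

HB.instance Definition _ := [isSub for @c0_seq R].
HB.instance Definition _ := [Choice of c0 R by <:].
HB.instance Definition _ := [SubChoice_isSubLmodule of c0 R by <:].

Implicit Types u v w : c0 R.

Definition c0_norm u : R := sup (range (fun n => `|u n|)).

Lemma c0_cvg u : u n @[n --> \oo] --> (0 : R^o).
Proof. by have := c0_seqP u; rewrite inE. Qed.

Lemma c0_ext u v : u =1 v -> u = v.
Proof. by move=> uv; apply/val_inj/funext. Qed.

Lemma c0_has_ubound u : has_ubound (range (fun n => `|u n|)).
Proof.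
have /cvgP/cvg_seq_bounded[M [_ uM]] := @c0_cvg u.
by exists (M + 1) => _ [n _ <-]; apply: uM => //; rewrite ltrDl.
Qed.

Lemma le_c0_norm u n : `|u n| <= c0_norm u.
Proof. by apply: ub_le_sup; [exact: c0_has_ubound|exists n]. Qed.

Lemma c0_norm_le u M : (forall n, `|u n| <= M) -> c0_norm u <= M.
Proof. by move=> uM; apply: ge_sup => [|_ [n _ <-]//]; exists `|u 0%N|, 0%N. Qed.

Lemma c0_norm_ge0 u : 0 <= c0_norm u.
Proof. exact: le_trans (le_c0_norm u 0). Qed.

Lemma c0_normD u v : c0_norm (u + v) <= c0_norm u + c0_norm v.
Proof.
apply: c0_norm_le => n; apply: (le_trans (ler_normD (u n) (v n))).
by apply: lerD; exact: le_c0_norm.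
Qed.

Lemma c0_normZ (a : R) u : c0_norm (a *: u) = `|a| * c0_norm u.
Proof.
apply/eqP; rewrite eq_le; apply/andP; split.
  apply: c0_norm_le => n; rewrite (_ : (a *: u) n = a * u n)// normrM.
  by rewrite ler_wpM2l// le_c0_norm.
have [->|a0] := eqVneq a 0; first by rewrite normr0 mul0r c0_norm_ge0.
rewrite -ler_pdivlMl ?normr_gt0//; apply: c0_norm_le => n.
rewrite ler_pdivlMl ?normr_gt0// -normrM.
exact: (le_c0_norm (a *: u)).
Qed.

Lemma c0_norm0_eq0 u : c0_norm u = 0 -> u = 0.
Proof.
move=> u0; apply: c0_ext => n; apply/eqP.
by rewrite (_ : (0 : c0 R) n = 0)// -normr_le0 -u0 le_c0_norm.
Qed.

HB.instance Definition _ :=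
  Lmodule_isNormed.Build R (c0 R) c0_normD c0_normZ c0_norm0_eq0.

Lemma le_c0_normB u v n : `|u n - v n| <= `|u - v|.
Proof. exact: (le_c0_norm (u - v)). Qed.

Lemma c0_complete (F : set_system (c0 R)) :
  ProperFilter F -> cauchy F -> cvg F.
Proof.
move=> FF /cauchyP Fc.
have Fcoord n : cvg (u n @[u --> F]).
  apply: R_complete; apply: cauchy_exP => e e0.
  have [u Fu] := Fc e e0; exists (u n).
  change (F [set v : c0 R | ball (u n) e (v n : R^o)]).
  apply: filterS Fu => v.
  rewrite -!ball_normE/= => uv; apply: le_lt_trans uv.
  exact: le_c0_normB.
pose l n : R^o := lim (u n @[u --> F]).
have l_near e (u : c0 R) : F (ball u e) -> forall n, `|u n - l n| <= e.
  move=> Fu n; have ul : `|u n - v n| @[v --> F] --> `|u n - l n|.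
    by apply: cvg_norm; apply: cvgB; [exact: cvg_cst|exact: Fcoord].
  rewrite -(cvg_lim _ ul)//.
  apply: limr_le; first by apply/cvg_ex; eexists; exact: ul.
  change (F [set v : c0 R | `|u n - v n| <= e]).
  apply: filterS Fu => v; rewrite -ball_normE/= => /ltW; apply: le_trans.
  exact: le_c0_normB.
have l0 : l \in c0_pred.
  rewrite inE; apply/cvgrPdist_le => e e0.
  have e2 : 0 < e / 2 by rewrite divr_gt0.
  have [u Fu] := Fc _ e2; have /cvgrPdist_le/(_ _ e2) := @c0_cvg u.
  apply: filterS => n; rewrite !sub0r !normrN => un.
  rewrite [e]splitr -[l n](subrK (u n)) (le_trans (ler_normD _ _))// lerD//.
  by rewrite distrC l_near.
apply/cvg_ex; exists (C0 l0); apply/(cvgrPdist_le (FF := FF)) => e e0.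
have e2 : 0 < e / 2 by rewrite divr_gt0.
have [u Fu] := Fc _ e2.
apply: filterS (Fu) => v; rewrite -ball_normE/= => /ltW uv.
apply: c0_norm_le => n; rewrite [e]splitr.
rewrite (_ : (C0 l0 - v) n = (l n - u n) + (u n - v n)); last first.
  by rewrite addrA subrK.
rewrite (le_trans (ler_normD _ _))// lerD//; first by rewrite distrC l_near.
by apply: le_trans uv; exact: le_c0_normB.
Qed.

HB.instance Definition _ := Uniform_isComplete.Build (c0 R) c0_complete.

Definition c0_le u v : Prop := forall n, u n <= v n.

Lemma c0_max_subproof u v :
  (fun n => Num.max (u n) (v n) : R^o) \in c0_pred.
Proof.
rewrite inE; apply/cvgrPdist_le => e e0.
have /cvgrPdist_le/(_ _ e0) := @c0_cvg u.
have /cvgrPdist_le/(_ _ e0) := @c0_cvg v.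
apply: filterS2 => n; rewrite !sub0r !normrN => un vn.
by case: (leP (u n) (v n)).
Qed.

Definition c0_max u v : c0 R := C0 (c0_max_subproof u v).

Lemma c0_le_refl u : c0_le u u. Proof. by []. Qed.

Lemma c0_le_anti u v : c0_le u v -> c0_le v u -> u = v.
Proof. by move=> uv vu; apply: c0_ext => n; apply/le_anti; rewrite uv vu. Qed.

Lemma c0_le_trans v u w : c0_le u v -> c0_le v w -> c0_le u w.
Proof. by move=> uv vw n; exact: le_trans (uv n) (vw n). Qed.

Lemma c0_le_maxl u v : c0_le u (c0_max u v).
Proof. by move=> n; rewrite /= le_max lexx. Qed.

Lemma c0_le_maxr u v : c0_le v (c0_max u v).
Proof. by move=> n; rewrite /= le_max lexx orbT. Qed.

Lemma c0_max_le u v w : c0_le u w -> c0_le v w -> c0_le (c0_max u v) w.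
Proof. by move=> uw vw n; rewrite /= ge_max uw vw. Qed.

Lemma c0_leD2r w u v : c0_le u v -> c0_le (u + w) (v + w).
Proof. by move=> uv n; exact: (lerD (uv n) (lexx (w n))). Qed.

Lemma c0_scale_ge0 (a : R) u : 0 <= a -> c0_le 0 u -> c0_le 0 (a *: u).
Proof. by move=> a0 u0 n; exact: (mulr_ge0 a0 (u0 n)). Qed.

Lemma c0_norm_solid u v :
  c0_le (c0_max u (- u)) (c0_max v (- v)) -> `|u| <= `|v|.
Proof.
move=> uv; apply: c0_norm_le => n; apply: le_trans (le_c0_norm v n).
by rewrite -!maxrN; exact: uv.
Qed.

HB.instance Definition _ := isBanachLattice.Build R (c0 R)
  c0_le_refl c0_le_anti c0_le_trans c0_le_maxl c0_le_maxr c0_max_le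
  c0_leD2r c0_scale_ge0 c0_norm_solid.

End c0_banach.

Section L1_construction.
Context d {T : measurableType d} {R : realType}.
Variable mu : {measure set T -> \bar R}.

Local Notation L1 := (LspaceType1 mu).

Lemma mfun_mu_measurable (f : {mfun_ mu, T >-> measurableTypeR R}) :
  measurable_fun [set: T] (f : T -> R).
Proof. by refine (@measurable_funP _ _ T (measurableTypeR R) _ (repr f)%qT). Qed.

Lemma L1_mem (f : L1) : (f : T -> R) \in Lfun mu 1.
Proof.
rewrite inE; apply/andP; split; rewrite inE/=; last exact: Lebesgue_finite.
exact: mfun_mu_measurable.
Qed.

Section L1_class.
Variables (f : T -> R) (hf : f \in Lfun mu 1).

Lemma L1_rep_measurable : measurable_fun [set: T] (f : T -> measurableTypeR R).
Proof. by move: hf; rewrite inE => /andP[]; rewrite inE. Qed.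

Definition L1_rep : {mfun T >-> measurableTypeR R} :=
  HB.pack_for {mfun T >-> measurableTypeR R} f
    (@isMeasurableFun.Build _ _ T (measurableTypeR R) f L1_rep_measurable).

Definition L1_pi : {mfun_ mu, T >-> measurableTypeR R} :=
  (\pi_({mfun_ mu, T >-> measurableTypeR R}) L1_rep)%qT.

Lemma L1_piE : \forall x \ae mu, L1_pi x = f x.
Proof.
have /eqmodP/asboolP : (repr L1_pi = L1_rep %[mod {mfun_ mu, T >-> measurableTypeR R}])%qT.
  by rewrite reprK.
by apply: filterS => x /(_ I).
Qed.

Lemma L1_pi_finite : finite_norm mu 1 L1_pi.
Proof.
rewrite /finite_norm Lnorm1.
rewrite (@ge0_ae_eq_integral _ _ _ mu setT _ (fun x => `|(f x)%:E|)%E)//.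
- by move: hf; rewrite inE => /andP[_]; rewrite inE/= /finite_norm Lnorm1.
- apply: measurableT_comp => //; apply/measurable_EFinP; exact: mfun_mu_measurable.
- apply: measurableT_comp => //; apply/measurable_EFinP.
  by move: hf; rewrite inE => /andP[]; rewrite inE.
- by apply: filterS L1_piE => x /= ->.
Qed.

HB.instance Definition _ :=
  isFinLebesgue.Build d T R mu 1%E (lexx 1%E) L1_pi L1_pi_finite.

Definition L1_of : L1 := L1_pi.

Lemma L1_ofE : \forall x \ae mu, L1_of x = f x.
Proof. exact: L1_piE. Qed.

End L1_class.

Lemma L1_ext (f g : L1) : (\forall x \ae mu, f x = g x) -> f = g.
Proof.
move: f g => [f [[Pf]]] [g [[Pg]]] /= fg.
have {}fg : f = g.
  rewrite -[f]reprK -[g]reprK; apply/eqmodP/asboolP.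
  by apply: filterS fg => x + _.
by subst g; rewrite (Prop_irrelevance Pf Pg).
Qed.

End L1_construction.

(* The operations on [LspaceType1 mu] are computed on representatives, so their
   pointwise characterizations only hold almost everywhere. *)
Section L1_lmodule.
Context d {T : measurableType d} {R : realType}.
Variable mu : {measure set T -> \bar R}.

Local Notation L1 := (LspaceType1 mu).

Implicit Types f g h : L1.

Lemma L1_integrable f : mu.-integrable [set: T] (fun x => (f x : R)%:E).
Proof. exact/Lfun1_integrable/L1_mem. Qed.

Lemma L1_zero_mem : (fun _ : T => 0 : R) \in Lfun mu 1.
Proof. by apply/Lfun1_integrable; exact: integrable0. Qed.

Lemma L1_add_mem f g : (fun x => f x + g x : R) \in Lfun mu 1.
Proof.
apply/Lfun1_integrable; rewrite /comp.
under eq_fun do rewrite EFinD.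
by apply: integrableD => //; exact: L1_integrable.
Qed.

Lemma L1_scale_mem (a : R) f : (fun x => a * f x : R) \in Lfun mu 1.
Proof.
apply/Lfun1_integrable; rewrite /comp.
under eq_fun do rewrite EFinM.
by apply: integrableZl => //; exact: L1_integrable.
Qed.

Lemma L1_max_mem f g : (fun x => Num.max (f x : R) (g x)) \in Lfun mu 1.
Proof.
apply/Lfun1_integrable.
apply: (le_integrable _ (g := ((abse \o (fun x => (f x : R)%:E)) \+
                               (abse \o (fun x => (g x : R)%:E)))%E)) => //.
- apply/measurable_EFinP; apply: measurable_maxr; exact: mfun_mu_measurable.
- move=> x _; rewrite /= lee_fin [leRHS]ger0_norm ?addr_ge0//.
  by case: (leP (f x : R) (g x)) => _; rewrite (lerDl, lerDr).
- by apply: integrableD => //; apply: integrable_abse; exact: L1_integrable.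
Qed.

Definition L1_zero : L1 := L1_of L1_zero_mem.
Definition L1_add f g : L1 := L1_of (L1_add_mem f g).
Definition L1_scale (a : R) f : L1 := L1_of (L1_scale_mem a f).
Definition L1_opp f : L1 := L1_scale (-1) f.
Definition L1_max f g : L1 := L1_of (L1_max_mem f g).

Lemma L1_zeroE : \forall x \ae mu, L1_zero x = 0 :> R.
Proof. exact: L1_ofE. Qed.

Lemma L1_addE f g : \forall x \ae mu, L1_add f g x = f x + g x :> R.
Proof. exact: L1_ofE. Qed.

Lemma L1_scaleE (a : R) f : \forall x \ae mu, L1_scale a f x = a * f x :> R.
Proof. exact: L1_ofE. Qed.

Lemma L1_maxE f g : \forall x \ae mu, L1_max f g x = Num.max (f x : R) (g x).
Proof. exact: L1_ofE. Qed.

Lemma L1_addA : associative L1_add.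
Proof.
move=> f g h; apply: L1_ext.
have [fgh gh] := (L1_addE f (L1_add g h), L1_addE g h).
apply: filterS2 (filterI fgh gh) (filterI (L1_addE (L1_add f g) h) (L1_addE f g)).
by move=> x [-> ->] [-> ->]; rewrite addrA.
Qed.

Lemma L1_addC : commutative L1_add.
Proof.
move=> f g; apply: L1_ext; apply: filterS2 (L1_addE f g) (L1_addE g f).
by move=> x -> ->; rewrite addrC.
Qed.

Lemma L1_add0 : left_id L1_zero L1_add.
Proof.
move=> f; apply: L1_ext; apply: filterS2 (L1_addE L1_zero f) L1_zeroE.
by move=> x -> ->; rewrite add0r.
Qed.

Lemma L1_addN : left_inverse L1_zero L1_opp L1_add.
Proof.
move=> f; apply: L1_ext.
apply: filterS3 (L1_addE (L1_opp f) f) (L1_scaleE (-1) f) L1_zeroE.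
by move=> x -> -> ->; rewrite mulN1r addNr.
Qed.

HB.instance Definition _ := gen_eqMixin L1.
HB.instance Definition _ := gen_choiceMixin L1.
HB.instance Definition _ :=
  GRing.isZmodule.Build L1 L1_addA L1_addC L1_add0 L1_addN.

Lemma L1_scaleA (a b : R) f : L1_scale a (L1_scale b f) = L1_scale (a * b) f.
Proof.
apply: L1_ext; apply: filterS3 (L1_scaleE a (L1_scale b f)) (L1_scaleE b f)
  (L1_scaleE (a * b) f).
by move=> x -> -> ->; rewrite mulrA.
Qed.

Lemma L1_scale1 : left_id 1 L1_scale.
Proof.
by move=> f; apply: L1_ext; apply: filterS (L1_scaleE 1 f) => x ->; rewrite mul1r.
Qed.

Lemma L1_scaleDr : right_distributive L1_scale +%R.
Proof.
move=> a f g; apply: L1_ext.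
apply: filterS3 (filterI (L1_scaleE a (L1_add f g)) (L1_addE f g))
  (L1_addE (L1_scale a f) (L1_scale a g))
  (filterI (L1_scaleE a f) (L1_scaleE a g)).
by move=> x [-> ->] -> [-> ->]; rewrite mulrDr.
Qed.

Lemma L1_scaleDl f : {morph L1_scale^~ f : a b / a + b}.
Proof.
move=> a b; apply: L1_ext.
apply: filterS3 (L1_scaleE (a + b) f) (L1_addE (L1_scale a f) (L1_scale b f))
  (filterI (L1_scaleE a f) (L1_scaleE b f)).
by move=> x -> -> [-> ->]; rewrite mulrDl.
Qed.

HB.instance Definition _ :=
  GRing.Zmodule_isLmodule.Build R L1 L1_scaleA L1_scale1 L1_scaleDr L1_scaleDl.

Definition L1_norm f : R := fine 'N[mu]_1[EFin \o (f : T -> R)]%E.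

Lemma L1_normE f : ((L1_norm f)%:E = \int[mu]_x `|f x : R|%:E)%E.
Proof.
rewrite /L1_norm Lnorm1 fineK// ge0_fin_numE; last exact: integral_ge0.
by have /integrableP[] := L1_integrable f.
Qed.

Lemma L1_measurable_norm f : measurable_fun [set: T] (fun x => `|f x : R|%:E).
Proof.
apply: measurableT_comp => //; apply: measurableT_comp => //.
Qed.

Lemma le_L1_norm f g :
  (\forall x \ae mu, `|f x : R| <= `|g x : R|) -> L1_norm f <= L1_norm g.
Proof.
move=> fg; rewrite -lee_fin !L1_normE; apply: ae_ge0_le_integral => //.
- exact: L1_measurable_norm.
- exact: L1_measurable_norm.
- by apply: filterS fg => x fgx _; rewrite lee_fin.
Qed.

Lemma L1_normD f g : L1_norm (f + g) <= L1_norm f + L1_norm g.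
Proof.
rewrite -lee_fin EFinD !L1_normE -ge0_integralD//; last 2 first.
- exact: L1_measurable_norm.
- exact: L1_measurable_norm.
apply: ae_ge0_le_integral => //.
- exact: L1_measurable_norm.
- by move=> x _; rewrite adde_ge0.
- by apply: emeasurable_funD; exact: L1_measurable_norm.
- by apply: filterS (L1_addE f g) => x -> _; rewrite lee_fin ler_normD.
Qed.

Lemma L1_normZ (a : R) f : L1_norm (a *: f) = `|a| * L1_norm f.
Proof.
apply: EFin_inj; rewrite EFinM !L1_normE -ge0_integralZl//; last first.
- exact: L1_measurable_norm.
apply: ge0_ae_eq_integral => //.
- exact: L1_measurable_norm.
- by apply: measurable_funeM; exact: L1_measurable_norm.
- by apply: filterS (L1_scaleE a f) => x -> _; rewrite normrM EFinM.
Qed.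

Lemma L1_norm0_eq0 f : L1_norm f = 0 -> f = 0.
Proof.
move=> f0; apply: L1_ext.
have mf : measurable_fun [set: T] (fun x => (f x : R)%:E).
  by apply/measurable_EFinP; exact: mfun_mu_measurable.
have int0 : (\int[mu]_x `|(f x : R)%:E| = 0)%E by rewrite -(L1_normE f) f0.
have h := (ae_eq_integral_abs mu measurableT mf).1 int0.
have {}h : \forall x \ae mu, f x = 0 :> R.
  by apply: filterS h => x /(_ I)[].
by apply: filterS2 h (@L1_zeroE) => x -> ->.
Qed.

HB.instance Definition _ :=
  Lmodule_isNormed.Build R L1 L1_normD L1_normZ L1_norm0_eq0.

End L1_lmodule.

Section complete_of_series.
Context {R : realType} (V : normedModType R).

Hypothesis cvg_series : forall v : nat -> V,
  (forall n, `|v n| <= 2^-1 ^+ n) -> exists s : V, series v n @[n --> \oo] --> s.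

Lemma complete_of_series (F : set_system V) :
  ProperFilter F -> cauchy F -> cvg F.
Proof.
move=> FF /cauchyP Fc.
have half_gt0 n : 0 < 2^-1 ^+ n / 2 :> R by rewrite divr_gt0// exprn_gt0.
have [x Fx] : {x : nat -> V & forall n, F (ball (x n) (2^-1 ^+ n / 2))}.
  exists (fun n => projT1 (cid (Fc _ (half_gt0 n)))) => n.
  by case: cid.
have xS n : `|x n.+1 - x n| <= 2^-1 ^+ n.
  have [y []] := filter_ex (filterI (Fx n) (Fx n.+1)).
  rewrite -ball_normE/= => xy xSy.
  rewrite -[x n.+1](subrK y) -addrA [leRHS]splitr.
  rewrite (le_trans (ler_normD _ _))// lerD//; last by rewrite distrC ltW.
  rewrite (le_trans (ltW xSy))// ler_pM2r ?invr_gt0//.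
  by rewrite ler_wiXn2l// invf_le1// ler1n.
have [s sE] := cvg_series xS.
have xE n : x n = series (fun n => x n.+1 - x n) n + x 0%N.
  by rewrite /series/= telescope_sumr// subrK.
apply/cvg_ex; exists (s + x 0%N); apply/(cvgrPdist_le (FF := FF)) => e e0.
have e2 : 0 < e / 2 by rewrite divr_gt0.
have half_cvg : 1 * 2^-1 ^+ n @[n --> \oo] --> (0 : R).
  by apply: cvg_geometric; rewrite ger0_norm ?invr_ge0// invf_lt1// ltr1n.
have [n [nl nh]] : exists n, `|s + x 0%N - x n| <= e / 2 /\ 2^-1 ^+ n <= e.
  move/cvgrPdist_le : sE => /(_ _ e2) sE.
  move/cvgrPdist_le : half_cvg => /(_ _ e0) half_cvg.
  have [n [h1 h2]] := filter_ex (filterI sE half_cvg); exists n; split.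
    by rewrite [x n]xE opprD addrACA subrr addr0.
  by move: h2; rewrite sub0r normrN mul1r ger0_norm// exprn_ge0// invr_ge0.
apply: filterS (Fx n) => y; rewrite -ball_normE/= => /ltW xy.
rewrite -(subrK (x n) (s + x 0%N)) -addrA [leRHS]splitr.
rewrite (le_trans (ler_normD _ _))// lerD// (le_trans xy)//.
by rewrite ler_pM2r ?invr_gt0.
Qed.

End complete_of_series.

Section L1_banach.
Context d {T : measurableType d} {R : realType}.
Variable mu : {measure set T -> \bar R}.

Local Notation L1 := (LspaceType1 mu).

Implicit Types f g h : L1.

Section cvg_series.
Variables (v : nat -> L1) (v_le : forall n, `|v n| <= 2^-1 ^+ n).

Let S (n : nat) (x : T) : R := \sum_(0 <= k < n) v k x.

Let G (x : T) : \bar R := (\sum_(k <oo) `|v k x : R|%:E)%E.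

Let S_ae n : \forall x \ae mu, series v n x = S n x.
Proof.
elim: n => [|n ih].
  rewrite /series/= /S big_geq//; apply: filterS (@L1_zeroE _ _ _ mu) => x.
  by rewrite big_geq.
have -> : series v n.+1 = series v n + v n by rewrite /series/= big_nat_recr.
apply: filterS2 ih (L1_addE (series v n) (v n)) => x Sx.
by rewrite /S big_nat_recr//= -/(S n x) -Sx.
Qed.

Let S_measurable n : measurable_fun [set: T] (S n).
Proof.
by apply: measurable_sum => k; exact: mfun_mu_measurable.
Qed.

Let G_measurable : measurable_fun [set: T] G.
Proof.
by apply: ge0_emeasurable_sum => // k *; exact: L1_measurable_norm.
Qed.

Let G_ge0 x : (0 <= G x)%E.
Proof. by apply: nneseries_ge0 => k _ _; rewrite lee_fin. Qed.

Let G_integrable : mu.-integrable [set: T] G.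
Proof.
apply/integrableP; split => //.
under eq_integral do rewrite gee0_abs//.
rewrite integral_nneseries//; last by move=> n; exact: L1_measurable_norm.
apply: (@le_lt_trans _ _ 2%:E); last exact: ltry.
apply: lime_le; first by apply: is_cvg_nneseries => n _ _; exact: integral_ge0.
apply: nearW => n; under eq_bigr do rewrite -L1_normE.
rewrite sumEFin lee_fin.
apply: (@le_trans _ _ (series (geometric 1 2^-1) n)).
  by apply: ler_sum => k _; rewrite /= mul1r; exact: v_le.
have := @geometric_le_lim R n 1 2^-1 ler01.
rewrite invr_gt0 ltr0n ger0_norm ?invr_ge0// invf_lt1// ltr1n => /(_ isT isT).
move=> /le_trans; apply; rewrite mul1r.
by rewrite [X in X - _](splitr 1) div1r addrK invrK.
Qed.

Let S_le n x : (`|(S n x)%:E| <= G x)%E.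
Proof.
rewrite /= (@le_trans _ _ (\sum_(0 <= k < n) `|v k x : R|)%:E)//.
  by rewrite lee_fin ler_norm_sum.
rewrite -sumEFin; apply: nneseries_lim_ge => k _ _.
by rewrite lee_fin.
Qed.

Let L (x : T) : \bar R := limn_esup (fun n => (S n x)%:E).

Let L_measurable : measurable_fun [set: T] L.
Proof.
by apply: measurable_fun_limn_esup => n; apply/measurable_EFinP.
Qed.

Let S_cvg : \forall x \ae mu, [set: T] x -> (S n x)%:E @[n --> \oo] --> L x.
Proof.
apply: filterS (integrable_ae measurableT G_integrable) => x /(_ I) Gx _.
have /cvg_ex[l Sl] : cvg (S n x @[n --> \oo]).
  apply: (@normed_cvg R R^o (fun k => v k x)).
  apply: nondecreasing_is_cvgn.
    by apply: nondecreasing_series => k _ _; exact: normr_ge0.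
  exists (fine (G x)) => _ [n _ <-].
  rewrite -lee_fin fineK// -sumEFin; apply: nneseries_lim_ge => k _ _.
  by rewrite lee_fin; exact: normr_ge0.
have Sl' : (S n x)%:E @[n --> \oo] --> l%:E 
  by apply: cvg_EFin => //; apply: nearW => n.
by rewrite /L (cvg_limn_einf_sup Sl').2.
Qed.

Lemma L1_cvg_series : exists s : L1, series v n @[n --> \oo] --> s.
Proof.
have mS n : measurable_fun [set: T] (fun x => (S n x)%:E).
  exact/measurable_EFinP.
have [L_int SL _] := dominated_convergence measurableT mS L_measurable S_cvg
  G_integrable (aeW mu (fun x n _ => S_le n x)).
have L_mem : (fun x => fine (L x)) \in Lfun mu 1.
  apply/Lfun1_integrable; apply: le_integrable L_int => //.
  - by apply/measurable_EFinP; exact: measurableT_comp.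
  - by move=> x _ /=; case: (L x) => [r||]//=; rewrite normr0 leey.
exists (L1_of L_mem).
have SLE n : (`|L1_of L_mem - series v n|%:E = \int[mu]_x `|(S n x)%:E - L x|)%E.
  rewrite [LHS](L1_normE (L1_of L_mem - series v n)).
  apply: ge0_ae_eq_integral => //.
  - exact: L1_measurable_norm.
  - by apply: measurableT_comp => //; exact: emeasurable_funB.
  have LsE := L1_addE (L1_of L_mem) (- series v n).
  have NE := L1_scaleE (-1) (series v n).
  have := integrable_ae measurableT L_int.
  apply: filterS3 (filterI LsE NE) (filterI (L1_ofE L_mem) (S_ae n)).
  move=> x [LsEx NEx] [Lx Sx] /(_ I) fin_Lx _.
  rewrite LsEx NEx Lx Sx mulN1r -[in RHS](fineK fin_Lx) -EFinB.
  by congr EFin; exact: distrC.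
apply/cvgrPdist_le => e e0.
have /fine_cvgP[_ /cvgrPdist_le/(_ _ e0)] := SL.
apply: filterS => n; rewrite sub0r normrN /= -SLE.
by apply: le_trans; exact: ler_norm.
Qed.

End cvg_series.

Definition L1_complete : forall F : set_system L1,
  ProperFilter F -> cauchy F -> cvg F := complete_of_series L1_cvg_series.

HB.instance Definition _ := Uniform_isComplete.Build L1 L1_complete.

Definition L1_le f g : Prop := \forall x \ae mu, (f x : R) <= g x.

Lemma L1_le_refl f : L1_le f f. Proof. exact: aeW. Qed.

Lemma L1_le_anti f g : L1_le f g -> L1_le g f -> f = g.
Proof.
move=> fg gf; apply: L1_ext; apply: filterS2 fg gf => x fg gf.
by apply/le_anti; rewrite fg gf.
Qed.

Lemma L1_le_trans g f h : L1_le f g -> L1_le g h -> L1_le f h.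
Proof. by apply: filterS2 => x; exact: le_trans. Qed.

Lemma L1_le_maxl f g : L1_le f (L1_max f g).
Proof. by apply: filterS (L1_maxE f g) => x ->; rewrite le_max lexx. Qed.

Lemma L1_le_maxr f g : L1_le g (L1_max f g).
Proof. by apply: filterS (L1_maxE f g) => x ->; rewrite le_max lexx orbT. Qed.

Lemma L1_max_le f g h : L1_le f h -> L1_le g h -> L1_le (L1_max f g) h.
Proof.
by apply: filterS3 (L1_maxE f g) => x -> fh gh; rewrite ge_max fh gh.
Qed.

Lemma L1_leD2r h f g : L1_le f g -> L1_le (f + h) (g + h).
Proof.
apply: filterS3 (L1_addE f h) (L1_addE g h) => x fhE ghE fg.
by rewrite fhE ghE lerD2r.
Qed.

Lemma L1_scale_ge0 (a : R) f : 0 <= a -> L1_le 0 f -> L1_le 0 (a *: f).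
Proof.
move=> a0; apply: filterS3 (@L1_zeroE _ _ _ mu) (L1_scaleE a f) => x zE afE.
by rewrite zE afE => f0; exact: mulr_ge0.
Qed.

Lemma L1_norm_solid f g :
  L1_le (L1_max f (- f)) (L1_max g (- g)) -> `|f| <= `|g|.
Proof.
move=> fg; apply: le_L1_norm.
apply: filterS3 fg (filterI (L1_maxE f (- f)) (L1_scaleE (-1) f))
  (filterI (L1_maxE g (- g)) (L1_scaleE (-1) g)).
move=> x /[swap] -[-> ->] /[swap] -[-> ->].
by rewrite !mulN1r !maxrN.
Qed.

HB.instance Definition _ := isBanachLattice.Build R L1
  L1_le_refl L1_le_anti L1_le_trans L1_le_maxl L1_le_maxr L1_max_le
  L1_leD2r L1_scale_ge0 L1_norm_solid.

End L1_banach.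

(* Main.v *)
(* Let h = S x0, fix a small delta, and let A, B be the (finite) sets of
   coordinates where x0 > 1 - delta, resp. x0 < - (1 - delta).  The positive
   operator P x = 1_{h >= 0} S (1_A x) + 1_{h < 0} S (1_B x) attains its norm at
   the point u0 equal to 1 on A, -1 on B and x0 elsewhere.  The defect
   D = S - P is small because for x in the unit ball the point
   y = |x| + |x0| - |x| |x0| of the unit ball satisfies
   delta |D x| + |h| <= S y almost everywhere, while |S y| <= 1 and
   |h| > 1 - eta in norm; hence |D| <= eta / delta.  Then T = P / |P u0|. *)
Require Import Defs.
From mathcomp Require Import all_boot all_order all_algebra.
From mathcomp Require Import all_classical all_reals all_analysis.
From HB Require Import structures.
From mathcomp Require Import measurable_realfun ring lra.
Import Order.TTheory GRing.Theory Num.Theory numFieldNormedType.Exports.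
Set Implicit Arguments.
Unset Strict Implicit.
Unset Printing Implicit Defensive.
Local Open Scope classical_set_scope.
Local Open Scope ring_scope.

(** * Boundedness and operator norm via the unit ball *)

Section operators.
Context {R : realType} {X Y : normedModType R}.

Lemma opnorm_le (T : X -> Y) (M : R) :
  (forall x, `|x| <= 1 -> `|T x| <= M) -> opnorm T <= M.
Proof.
move=> TM; apply: ge_sup => [|_ [x /= x1 <-]]; last exact: TM.
by exists `|T 0|, 0; rewrite //= normr0.
Qed.

(** The bound [M] certifies that the set under [sup] is bounded, so that [sup] is not the default
    0. *)
Lemma le_opnorm (T : X -> Y) (M : R) :
  (forall x, `|x| <= 1 -> `|T x| <= M) ->
  forall x, `|x| <= 1 -> `|T x| <= opnorm T.
Proof.
move=> TM x x1; apply: ub_le_sup; last by exists x.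
by exists M => _ [y /= y1 <-]; exact: TM.
Qed.

Lemma bounded_operatorP (T : {linear X -> Y}) :
  bounded_operator T <-> exists M : R, forall x, `|x| <= 1 -> `|T x| <= M.
Proof.
split=> [/linear_boundedP bT|[M TM]].
  have [M [M0 TM]] := filter_ex (filterI (nbhs_pinfty_ge (num_real 0)) bT).
  exists M => x x1; apply: le_trans (TM x) _.
  by rewrite ler_piMr.
exists M; split; first exact: num_real.
move=> N MN; near=> x; apply: le_trans (TM x _) (ltW MN).
near: x; exact: (@nbhs0_le R X 1).
Unshelve. all: by end_near.
Qed.

Lemma norm1_operator_le (T : {linear X -> Y}) :
  norm1_operator T -> forall x, `|x| <= 1 -> `|T x| <= 1.
Proof.
move=> [/bounded_operatorP[M TM] T1] x x1; rewrite -[leRHS]T1.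
exact: le_opnorm TM x x1.
Qed.

Lemma norm1_operatorP (T : {linear X -> Y}) (u : X) :
  (forall x, `|x| <= 1 -> `|T x| <= 1) -> `|u| <= 1 -> `|T u| = 1 ->
  norm1_operator T.
Proof.
move=> T1 u1 Tu; split; first by apply/bounded_operatorP; exists 1.
apply/eqP; rewrite eq_le opnorm_le//= -[leLHS]Tu.
exact: le_opnorm T1 _ u1.
Qed.

End operators.

(** * Coordinatewise constructions in [c0] *)

Section c0_sequences.
Context {R : realType}.
Implicit Types (u v x : c0 R) (A : pred nat).

(** The test by which every sequence built below is shown to tend to 0. *)
Lemma c0_dominated (k : R) u (v : nat -> R^o) :
  (forall n, `|v n| <= k * `|u n|) -> v \in c0_pred.
Proof.
move=> vu; rewrite inE.
have ku : k * `|u n| @[n --> \oo] --> (0 : R).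
  rewrite -[X in _ --> X](mulr0 k); apply: cvgMr.
  by rewrite -[X in _ --> X](@normr0 R R^o); apply: cvg_norm; exact: c0_cvg.
apply: (@squeeze_cvgr _ _ _ _ (fun n => - (k * `|u n|)) (fun n => k * `|u n|)).
- by apply: nearW => n; rewrite -ler_norml vu.
- by rewrite -[X in _ --> X]oppr0; apply: cvgN.
- exact: ku.
Qed.

Lemma c0_add_seqE u v n : (u + v) n = u n + v n. Proof. by []. Qed.
Lemma c0_scale_seqE (a : R) u n : (a *: u) n = a * u n. Proof. by []. Qed.

Lemma c0_opp_seqE u n : (- u) n = - u n. Proof. by []. Qed.

Lemma c0_norm_leP u (M : R) : (forall n, `|u n| <= M) <-> `|u| <= M.
Proof.
split=> [|uM n]; first exact: c0_norm_le.
exact: le_trans (le_c0_norm u n) uM.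
Qed.

Lemma c0_abs_subproof u : (fun n => `|u n| : R^o) \in c0_pred.
Proof. by apply: (@c0_dominated 1 u) => n; rewrite mul1r normr_id. Qed.

Definition c0_abs u : c0 R := C0 (c0_abs_subproof u).

Lemma c0_norm_abs u : `|c0_abs u| <= `|u|.
Proof. by apply/c0_norm_leP => n; rewrite normr_id; exact: le_c0_norm. Qed.

Lemma c0_restrict_subproof A u :
  (fun n => if A n then u n else 0 : R^o) \in c0_pred.
Proof.
apply: (@c0_dominated 1 u) => n; rewrite mul1r.
by case: ifP => // _; rewrite normr0.
Qed.

Definition c0_restrict A u : c0 R := C0 (c0_restrict_subproof A u).

Lemma c0_restrict_linear A : linear (c0_restrict A).
Proof.
move=> a u v; apply: c0_ext => n; rewrite c0_add_seqE c0_scale_seqE /=.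
by case: ifP => // _; rewrite mulr0 addr0.
Qed.

HB.instance Definition _ A :=
  GRing.isLinear.Build R (c0 R) (c0 R) _ (c0_restrict A) (c0_restrict_linear A).

Lemma c0_restrict_ge0 A u : 0 <=L u -> 0 <=L c0_restrict A u.
Proof. by move=> u0 n /=; case: ifP => // _; exact: u0. Qed.

Lemma c0_restrictC A u : c0_restrict A u + c0_restrict (predC A) u = u.
Proof.
apply: c0_ext => n; rewrite c0_add_seqE /=.
by case: (A n); rewrite /= ?addr0 ?add0r.
Qed.

(* [|x| + |v| - |x| |v|] stands in for the constant sequence 1, which is not
   in [c0]. *)
Lemma c0_probsum_subproof x v :
  (fun n => `|x n| + `|v n| - `|x n| * `|v n| : R^o) \in c0_pred.
Proof.
apply: (@c0_dominated (1 + `|v|) (c0_abs x + c0_abs v)) => n.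
have vn : `|v n| <= `|v| := le_c0_norm v n.
rewrite c0_add_seqE /=; move: vn; have := normr_ge0 (x n); have := normr_ge0 (v n).
move: `|x n| `|v n| `|v| => a b c b0 a0 bc.
have ab0 : 0 <= a * b by rewrite mulr_ge0.
have acb0 : 0 <= a * (c - b) by rewrite mulr_ge0// subr_ge0.
have bc0 : 0 <= b * c by rewrite mulr_ge0// (le_trans b0).
by rewrite (ger0_norm (addr_ge0 a0 b0)) ler_norml; apply/andP; split; lra.
Qed.

Definition c0_probsum x v : c0 R := C0 (c0_probsum_subproof x v).

(** For a, b in [0, 1] the value a + b - a b = 1 - (1 - a)(1 - b) stays in [0, 1]. *)
Lemma c0_probsum_le1 x v : `|x| <= 1 -> `|v| <= 1 -> `|c0_probsum x v| <= 1.
Proof.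
move=> /c0_norm_leP x1 /c0_norm_leP v1; apply/c0_norm_leP => n /=.
have := x1 n; have := v1 n.
have := normr_ge0 (x n); have := normr_ge0 (v n).
set a := `|x n|; set b := `|v n| => b0 a0 b1 a1.
by rewrite ler_norml; apply/andP; split; nra.
Qed.

End c0_sequences.

(** * Additivity of the norm and pasting of functions in [L1] *)

Section L1_lemmas.
Context d {T : measurableType d} {R : realType}.
Variable mu : {measure set T -> \bar R}.
Local Notation L1 := (LspaceType1 mu).
Implicit Types f g h k : L1.

(** The integral is additive on nonnegative functions, which reverses the triangle inequality. This
    lets the defect be bounded by the room left between |S x0| and 1. *)
Lemma L1_norm_superadd f g h :
  (\forall x \ae mu, `|f x : R| + `|g x : R| <= `|h x : R|) ->
  `|f| + `|g| <= `|h|.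
Proof.
move=> fgh; rewrite -lee_fin EFinD.
rewrite [X in (X + _)%E](L1_normE f) [X in (_ + X)%E](L1_normE g).
rewrite [leRHS](L1_normE h) -ge0_integralD//; last 2 first.
- exact: L1_measurable_norm.
- exact: L1_measurable_norm.
apply: ae_ge0_le_integral => //.
- by move=> x _; rewrite adde_ge0.
- by apply: emeasurable_funD; exact: L1_measurable_norm.
- exact: L1_measurable_norm.
- by apply: filterS fgh => x fgx _; rewrite -EFinD lee_fin.
Qed.

Lemma L1_le0P f : 0 <=L f <-> \forall x \ae mu, 0 <= f x :> R.
Proof.
split; last by apply: filterS2 (@L1_zeroE _ _ _ mu) => x zx fx; rewrite zx.
by apply: filterS2 (@L1_zeroE _ _ _ mu) => x zx; rewrite zx.
Qed.

Lemma L1_paste_mem k f g :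
  (fun x => if (0 <= k x :> R) then (f x : R) else g x) \in Lfun mu 1.
Proof.
apply/Lfun1_integrable.
apply: (le_integrable _ (g := ((abse \o (fun x => (f x : R)%:E)) \+
                               (abse \o (fun x => (g x : R)%:E)))%E)) => //.
- apply/measurable_EFinP; apply: measurable_fun_ifT.
  + by apply: measurable_fun_ler => //; exact: mfun_mu_measurable.
  + exact: mfun_mu_measurable.
  + exact: mfun_mu_measurable.
- move=> x _; rewrite /= lee_fin [leRHS]ger0_norm ?addr_ge0//.
  by case: ifP => _; rewrite (lerDl, lerDr).
- by apply: integrableD => //; apply: integrable_abse; exact: L1_integrable.
Qed.

Definition L1_paste k f g : L1 := L1_of (L1_paste_mem k f g).

Lemma L1_pasteE k f g : \forall x \ae mu,
  L1_paste k f g x = (if (0 <= k x :> R) then (f x : R) else g x).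
Proof. exact: L1_ofE. Qed.

(** Joint linearity in the pasted pair, for a fixed sign pattern [k], yields both the linearity of
    [peak] and the splitting of [S]. *)
Lemma L1_paste_linear k (a : R) f f' g g' :
  L1_paste k (a *: f + f') (a *: g + g') =
  a *: L1_paste k f g + L1_paste k f' g'.
Proof.
apply: L1_ext.
apply: filterS3 (filterI (L1_pasteE k (a *: f + f') (a *: g + g'))
                   (L1_addE (a *: L1_paste k f g) (L1_paste k f' g')))
  (filterI (filterI (L1_addE (a *: f) f') (L1_addE (a *: g) g'))
     (filterI (L1_scaleE a f) (L1_scaleE a g)))
  (filterI (L1_scaleE a (L1_paste k f g))
     (filterI (L1_pasteE k f g) (L1_pasteE k f' g'))).
move=> x [-> ->] [[e1 e2] [e3 e4]] [-> [-> ->]].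
by rewrite e1 e2 e3 e4; case: ifP.
Qed.

Lemma L1_paste_id k f : L1_paste k f f = f.
Proof. by apply: L1_ext; apply: filterS (L1_pasteE k f f) => x ->; case: ifP. Qed.

End L1_lemmas.

(** * Positive operators from [c0] to [L1] and their pasted restrictions *)

Section positive_operators.
Context {R : realType}.

Lemma positive_le (X Y : banachLatticeType R) (T : {linear X -> Y}) (u v : X) :
  positive_operator T -> u <=L v -> T u <=L T v.
Proof.
move=> T0 /(vleD2r (- u)); rewrite subrr => /T0 /(vleD2r (T u)).
by rewrite add0r linearB subrK.
Qed.

Context d {Omega : measurableType d} (mu : {measure set Omega -> \bar R}).
Variables (S : {linear c0 R -> LspaceType1 mu}) (S0 : positive_operator S).

(** Monotonicity of [S] is applied to u <= v and to - u <= v. Coordinatewise bounds thus become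
    almost everywhere bounds. *)
Lemma positive_ae_abs_le (u v : c0 R) : (forall n, `|u n| <= v n) ->
  \forall z \ae mu, `|S u z : R| <= S v z.
Proof.
move=> uv.
have le1 : S u <=L S v.
  by apply: positive_le => // n; exact: le_trans (ler_norm _) (uv n).
have le2 : S (- u) <=L S v.
  apply: positive_le => // n; apply: le_trans (uv n).
  by rewrite -normrN; exact: ler_norm.
rewrite linearN in le2.
apply: filterS3 le1 le2 (L1_scaleE (-1) (S u)) => z h1 h2 e.
by rewrite ler_norml h1 andbT lerNl; move: h2; rewrite e mulN1r.
Qed.

Section peak.
Variables (k : LspaceType1 mu) (A B : pred nat).

(** [A] and [B] are arbitrary because P and the defect D = S - P both have this shape, D with the
    complementary sets. *)
Definition peak (x : c0 R) : LspaceType1 mu :=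
  L1_paste k (S (c0_restrict A x)) (S (c0_restrict B x)).

Lemma peak_linear : linear peak.
Proof. by move=> a u v; rewrite /peak !linearP L1_paste_linear. Qed.

HB.instance Definition _ :=
  GRing.isLinear.Build R (c0 R) (LspaceType1 mu) _ peak peak_linear.

Lemma peakE x : \forall z \ae mu, peak x z =
  (if 0 <= k z :> R then S (c0_restrict A x) z : R else S (c0_restrict B x) z).
Proof. exact: L1_pasteE. Qed.

Lemma peak_positive : positive_operator peak.
Proof.
move=> x x0; apply/L1_le0P.
have /L1_le0P hA := S0 (c0_restrict_ge0 A x0).
have /L1_le0P hB := S0 (c0_restrict_ge0 B x0).
by apply: filterS3 hA hB (peakE x) => z a b ->; case: ifP.
Qed.

End peak.

Lemma peakC k A B x : S x = peak k A B x + peak k (predC A) (predC B) x.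
Proof.
rewrite -[X in X + _]scale1r /peak -L1_paste_linear !scale1r -!linearD.
by rewrite !c0_restrictC L1_paste_id.
Qed.

(** Both branches are dominated by S |x| almost everywhere. *)
Lemma peak_norm_le1 k A B x : (forall y, `|y| <= 1 -> `|S y| <= 1) ->
  `|x| <= 1 -> `|peak k A B x| <= 1.
Proof.
move=> S1 x1; apply: le_trans (S1 (c0_abs x) _); last first.
  exact: le_trans (c0_norm_abs x) x1.
apply: le_L1_norm.
have hle C : forall n, `|c0_restrict C x n| <= c0_abs x n.
  by move=> n /=; case: ifP => // _; rewrite normr0.
apply: filterS3 (positive_ae_abs_le (hle A)) (positive_ae_abs_le (hle B))
  (peakE k A B x) => z hA hB ->.
by apply: le_trans (ler_norm _); case: ifP.
Qed.

(** * Approximation when [S] almost attains its norm at [x0] *)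

Section near_peak.
Variables (x0 : c0 R) (delta : R).
Hypotheses (d0 : 0 < delta) (d2 : 2 * delta <= 1) (x01 : `|x0| = 1).
Hypothesis S1 : forall y, `|y| <= 1 -> `|S y| <= 1.

(** Since delta <= 1/2, [A] and [B] are disjoint and |x0 n| > 1/2 on both. *)
Let A : pred nat := fun n => 1 - delta < x0 n.
Let B : pred nat := fun n => x0 n < - (1 - delta).

Let x0_le1 n : `|x0 n| <= 1.
Proof. by move: n; apply/c0_norm_leP; rewrite x01. Qed.

(** The right-hand side is b (1 - |t|) + (|t| - t) >= 0. If 0 <= t <= 1 - delta, it is b (1 - t) >=
    delta b; if t < 0, it is b - t (2 - b) >= b. *)
Let gap (b t : R) : 0 <= b -> b <= 1 -> `|t| <= 1 ->
  delta * (if ~~ (1 - delta < t) then b else 0) <= b + `|t| - b * `|t| - t.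
Proof.
move=> b0 b1 t1; have [hd0 hd2] := (d0, d2).
have [tlt|tge] /= := ltP (1 - delta) t.
  have : 0 <= b * (1 - `|t|) by rewrite mulr_ge0// subr_ge0.
  by have := ler_norm t; lra.
have [t0|t0] := leP 0 t.
  have : 0 <= b * (1 - t - delta) by apply: mulr_ge0 => //; lra.
  by rewrite ger0_norm//; lra.
have : 0 <= - t * (2 - b) by apply: mulr_ge0; lra.
have : 0 <= b * (1 - delta) by apply: mulr_ge0 => //; lra.
by rewrite ltr0_norm//; lra.
Qed.

Lemma peakC_norm_le x : `|x| <= 1 ->
  delta * `|peak (S x0) (predC A) (predC B) x| + `|S x0| <= 1.
Proof.
move=> x1; pose y := c0_probsum x x0.
have y1 : `|S y| <= 1 by apply/S1/c0_probsum_le1; rewrite ?x01.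
apply: le_trans y1; rewrite -[delta in leLHS](ger0_norm (ltW d0)) -normrZ.
have x_le1 n : `|x n| <= 1 by move: n; apply/c0_norm_leP.
have leA n : `|(delta *: c0_restrict (predC A) x) n| <= (y - x0) n.
  rewrite c0_scale_seqE normrM (gtr0_norm d0) c0_add_seqE c0_opp_seqE /=.
  by rewrite (fun_if Num.norm) normr0; apply: gap.
have leB n : `|(delta *: c0_restrict (predC B) x) n| <= (y + x0) n.
  rewrite c0_scale_seqE normrM (gtr0_norm d0) c0_add_seqE /=.
  (* The case of [B] is that of [A] for - x0, so [gap] applies with t = - x0 n. *)
  rewrite /y /= -[X in _ + X]opprK -(normrN (x0 n)).
  have -> : B n = (1 - delta < - x0 n) by rewrite /B ltrNr.
  by rewrite (fun_if Num.norm) normr0; apply: gap; rewrite ?normrN.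
have := positive_ae_abs_le leA; have := positive_ae_abs_le leB.
rewrite !linearZ linearD linearB => aeB aeA.
apply: L1_norm_superadd.
apply: filterS3 (filterI aeA aeB)
  (filterI (L1_addE (S y) (S x0)) (filterI (L1_addE (S y) (- S x0))
    (L1_scaleE (-1) (S x0))))
  (filterI (L1_scaleE delta (peak (S x0) (predC A) (predC B) x))
    (filterI (peakE (S x0) (predC A) (predC B) x)
    (filterI (L1_scaleE delta (S (c0_restrict (predC A) x)))
      (L1_scaleE delta (S (c0_restrict (predC B) x)))))).
move=> z [hA hB] [eD [eB eN]] [eP [ep [eA eB']]].
rewrite eP ep; move: hA hB; rewrite eA eB' eD eB eN.
(* With h = S x0, where h >= 0 the bound from [leA] reads delta |D x| <= S y - |h|; where h < 0 the
   one from [leB] does. *)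
case: ifP => [h0 + _|/negbT]; rewrite ?(ger0_norm h0) => h.
  by apply: le_trans (ler_norm _); lra.
rewrite -ltNge in h; rewrite (ltr0_norm h) => _ hB.
by apply: le_trans (ler_norm _); lra.
Qed.

Lemma saturate_subproof :
  (fun n => if A n then 1 else if B n then -1 else x0 n : R^o) \in c0_pred.
Proof.
(* The factor 2 suffices because a coordinate is changed to 1 or -1 only where |x0 n| > 1/2. *)
apply: (@c0_dominated _ 2 x0) => n; rewrite /A /B.
have hd2 := d2; have := ler_norm (x0 n); have := ler_norm (- x0 n).
have := normr_ge0 (x0 n).
rewrite normrN; set b := `|x0 n| => ? ? ?.
case: ltP => /= h; first by rewrite normr1; lra.
by case: ltP => /= h'; rewrite ?normrN1 -/b; lra.
Qed.

Definition saturate : c0 R := C0 saturate_subproof.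

Lemma saturate_norm : `|saturate| = 1.
Proof.
apply/eqP; rewrite eq_le; apply/andP; split.
  apply/c0_norm_leP => n /=.
  by case: ifP => _; [|case: ifP => _]; rewrite ?normrN1 ?normr1.
(* A norm below 1 would make [A] and [B] empty, hence |x0| <= 1 - delta. *)
rewrite leNgt; apply/negP => u1; have hd0 := d0.
have : `|x0| <= 1 - delta.
  apply/c0_norm_leP => n; have [AB|] := boolP (A n || B n); last first.
    by rewrite negb_or /A /B -!leNgt ler_norml andbC.
  suff un : `|saturate n| = 1.
    by have := le_c0_norm saturate n; rewrite un leNgt u1.
  rewrite /=; move: AB; case: (A n) => [_|/= ->]; first exact: normr1.
  exact: normrN1.
by rewrite x01; lra.
Qed.

Lemma saturate_dist : `|saturate - x0| <= delta.
Proof.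
apply/c0_norm_leP => n; rewrite c0_add_seqE c0_opp_seqE /=.
have := x0_le1 n; rewrite ler_norml => /andP[h1 h2]; have hd0 := d0.
rewrite /A /B; case: ltP => /= hA; first by rewrite ger0_norm; lra.
case: ltP => /= hB; first by rewrite ler0_norm; lra.
by rewrite subrr normr0; exact: ltW.
Qed.

(** For x0 >= 0 the set [B] is empty, so the value -1 is never taken. *)
Lemma saturate_ge0 : 0 <=L x0 -> 0 <=L saturate.
Proof.
move=> x0_ge0 n; rewrite /= /A /B; have x0n : 0 <= x0 n := x0_ge0 n.
have := d2; case: ltP => //= hA h2; case: ltP => //= hB.
by exfalso; move: x0n hB h2; lra.
Qed.

(** Each branch of P sees only coordinates where [saturate] is constantly 1, or constantly -1, so
    the comparison of absolute values is pointwise. *)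
Lemma peak_le_saturate x : `|x| <= 1 ->
  `|peak (S x0) A B x| <= `|peak (S x0) A B saturate|.
Proof.
move=> x1; have x_le1 n : `|x n| <= 1 by move: n; apply/c0_norm_leP.
apply: le_L1_norm.
have leA n : `|c0_restrict A x n| <= c0_restrict A saturate n.
  by rewrite /=; case: (A n) => //; rewrite normr0.
have leB n : `|c0_restrict B x n| <= (- c0_restrict B saturate) n.
  rewrite c0_opp_seqE /=; have [Bn|_] := boolP (B n); last by rewrite normr0 oppr0.
  suff -> : A n = false by rewrite opprK.
  apply/negbTE; move: Bn; have [hd0 hd2] := (d0, d2).
  by rewrite /A /B -leNgt; lra.
have := positive_ae_abs_le leB; rewrite linearN => aeB.
apply: filterS3 (filterI (positive_ae_abs_le leA) aeB) 
  (L1_scaleE (-1) (S (c0_restrict B saturate)))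
  (filterI (peakE (S x0) A B x) (peakE (S x0) A B saturate)).
move=> z [hA hB] e [-> ->]; move: hB; rewrite e mulN1r => hB.
case: ifP => _; first by apply: le_trans hA (ler_norm _).
by rewrite -[leRHS]normrN; apply: le_trans hB (ler_norm _).
Qed.

(** The smallness of [eta] keeps P nonzero at [saturate], so P can be normalized. The error is eta /
    delta from D plus 1 - m < eta + eta / delta from the normalization. *)
Lemma peak_approx (eta : R) : `|S x0| > 1 - eta -> eta + eta / delta < 1 ->
  exists (u0 : c0 R) (T : {linear c0 R -> LspaceType1 mu}),
    [/\ `|u0| = 1 /\ (0 <=L x0 -> 0 <=L u0),
        norm1_operator T /\ positive_operator T,
        `|T u0| = 1, `|u0 - x0| <= delta &
        opnorm (T \- S) <= eta + 2 * (eta / delta)].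
Proof.
move=> Sx0 eta1; have hd0 := d0.
pose P := peak (S x0) A B; pose D := peak (S x0) (predC A) (predC B).
pose m : R := `|P saturate|.
have Dle x : `|x| <= 1 -> `|D x| <= eta / delta.
  move=> x1; rewrite ler_pdivlMr// mulrC.
  by have := peakC_norm_le x1; rewrite -/D; move: Sx0; lra.
have Ple x : `|x| <= 1 -> `|P x| <= m by exact: peak_le_saturate.
have m1 : m <= 1 by apply: peak_norm_le1; rewrite ?saturate_norm.
(* Evaluate S = P + D at [x0], where |S x0| > 1 - eta. *)
have m_ge : 1 - eta - eta / delta < m.
  have x0le : `|x0| <= 1 by rewrite x01.
  have := Dle _ x0le; have := Ple _ x0le; have := ler_normD (P x0) (D x0).
  by rewrite -peakC; move: Sx0; lra.
have m0 : 0 < m by lra.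
pose T : {linear c0 R -> LspaceType1 mu} := m^-1 \*: P.
have TE x : T x = m^-1 *: P x by [].
have normT x : `|T x| = m^-1 * `|P x| by rewrite TE normrZ gtr0_norm ?invr_gt0.
have Tu : `|T saturate| = 1 by rewrite normT mulVf ?gt_eqF.
exists saturate, T; split => //.
- split; [exact: saturate_norm|exact: saturate_ge0].
- split.
    apply: (norm1_operatorP (u := saturate)); rewrite ?saturate_norm//.
    by move=> x x1; rewrite normT ler_pdivrMl// mulr1 Ple.
  by move=> x xge0; apply: vscale_ge0; [rewrite invr_ge0 ltW|exact: peak_positive].
- exact: saturate_dist.
- apply: opnorm_le => x x1.
  rewrite /= (peakC (S x0) A B x) opprD addrA -/(P x) -/(D x).
  have -> : T x - P x = (m^-1 - 1) *: P x by rewrite scalerBl scale1r.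
  apply: le_trans (ler_normB _ _) _; rewrite normrZ ger0_norm; last first.
    by rewrite subr_ge0 invf_ge1.
  have : (m^-1 - 1) * `|P x| <= 1 - m.
    apply: le_trans (ler_wpM2l _ (Ple _ x1)) _.
      by rewrite subr_ge0 invf_ge1.
    by rewrite mulrBl mulVf ?gt_eqF// mul1r.
  by have := Dle _ x1; lra.
Qed.

End near_peak.
End positive_operators.

Theorem theorem3p1 (R : realType) (d : measure_display)
    (Omega : measurableType d) (mu : {measure set Omega -> \bar R}) :
  BPBp_positive (c0 R) (LspaceType1 mu) /\
  (forall eps : R, 0 < eps < 1 ->
   exists2 eta : R, 0 < eta < eps &
     forall S : {linear c0 R -> LspaceType1 mu},
       norm1_operator S -> positive_operator S ->
     forall x0 : c0 R, `|x0| = 1 -> `|S x0| > 1 - eta ->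
     exists (u0 : c0 R) (T : {linear c0 R -> LspaceType1 mu}),
       [/\ `|u0| = 1 /\ (0 <=L x0 -> 0 <=L u0),
           norm1_operator T /\ positive_operator T,
           `|T u0| = 1, `|u0 - x0| < eps & opnorm (T \- S) < eps]).
Proof.
(* The second conjunct implies the first, so it is the one to prove. *)
have impl_and (P Q : Prop) : Q -> (Q -> P) -> P /\ Q by tauto.
apply: impl_and => [eps eps01|H eps]; last first.
  move=> /H[eta eta01 {}H]; exists eta => // S S1 S0 x0 x01 Sx0.
  have [u0 [T [[u01 _] T1 Tu u0x0 TS]]] := H S S1 S0 x0 x01 Sx0.
  by exists u0, T; split.
have [eps0 eps1] : 0 < eps /\ eps < 1 by apply/andP.
(* With delta = eps / 2 and eta = eps^2 / 16, the total error eta + 2 (eta / delta) is eps^2 / 16 +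
   eps / 4 < eps. *)
have etaE : eps ^+ 2 / 16 / (eps / 2) = eps / 8.
  by field; rewrite gt_eqF.
exists (eps ^+ 2 / 16); first by apply/andP; split; nra.
move=> S S1 S0 x0 x01 Sx0.
have [|||u0 [T [u0P TP Tu u0x0 TS]]] := @peak_approx _ _ _ mu S S0 x0 (eps / 2)
  _ _ x01 (norm1_operator_le S1) _ Sx0.
- by rewrite divr_gt0.
- lra.
- by rewrite etaE; nra.
exists u0, T; split=> //; first by apply: le_lt_trans u0x0 _; lra.
by apply: le_lt_trans TS _; rewrite etaE; nra.
Qed.
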